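(* Let $Y\in\mathcal{G}$. Then for all $n\in\mathbb{N}_0$, $$\frac{d}{dx}W_n^Y(x)=\sum_{k=0}^n\binom{n}{k}\left[\mathbb{E}[Y^{n-k}]\sum_{i=0}^k\binom{k}{i}W_i^Y(x)\,W_{k-i}^Y(x)-W_k^Y(x)\,W_{n-k}^Y(x)\right].$$
   Context: $\mathbb{N}_0=\{0,1,2,\dots\}$. $\mathcal{G}$ is the set of real random variables $Y$ such that $\mathbb{E}|Y|^n<\infty$ for all $n\in\mathbb{N}_0$ and, for some $r>0$, $\lim_{n\to\infty}|t|^n\mathbb{E}|Y|^n/n!=0$ for all $|t|<r$. Let $Y_1,Y_2,\dots$ be i.i.d. copies of $Y$, $S_0=0$ and $S_i=Y_1+\cdots+Y_i$ for $i\ge1$. The convention $0^0=1$ is used. For $x\ge0$ the probabilistic Fubini polynomials associated with $Y$ are $$W_n^Y(x)=\sum_{i=0}^{\infty}\mathbb{E}[S_i^n]\,P\{G_{\eta(x)}=i+1\}=\sum_{i=0}^\infty \mathbb{E}[S_i^n]\,\frac{1}{1+x}\left(\frac{x}{1+x}\right)^i,$$ where $\eta(x)=1/(1+x)$ and $G_p$ is geometric with $P\{G_p=i\}=p(1-p)^{i-1}$, $i\ge1$. Equivalently, $W_n^Y(x)=\sum_{k=0}^n S_Y(n,k)\,k!\,x^k$, which is a polynomial in $x$, where $S_Y(n,k)=\frac{1}{k!}\sum_{j=0}^k(-1)^{k-j}\binom{k}{j}\mathbb{E}S_j^n$; the derivative is that of this polynomial. *)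

(* Defs.v *)
From HB Require Import structures.
From mathcomp Require Import all_boot all_order all_algebra finmap.
From mathcomp Require Import all_classical all_reals all_analysis.

Set Implicit Arguments.
Unset Strict Implicit.
Unset Printing Implicit Defensive.

Import Order.TTheory GRing.Theory Num.Theory.
Import numFieldNormedType.Exports.

Local Open Scope classical_set_scope.
Local Open Scope ring_scope.

(* The expectation of the library is extended-real valued; [fine] is harmless
   here because every moment used below is finite when Y is in the class G. *)
Definition moment {d : measure_display} {T : measurableType d} {R : realType}
    (P : probability T R) (X : T -> R) (n : nat) : R :=
  fine ('E_P[fun w => (X w ^+ n)%R])%E.

Definition abs_moment {d : measure_display} {T : measurableType d}
    {R : realType} (P : probability T R) (X : T -> R) (n : nat) : \bar R :=
  ('E_P[fun w => (`|X w| ^+ n)%R])%E.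

Definition in_class_G {d : measure_display} {T : measurableType d}
    {R : realType} (P : probability T R) (Y : {RV P >-> R}) : Prop :=
  (forall n : nat, (abs_moment P Y n < +oo)%E) /\
  (exists2 r : R, 0 < r & forall t : R, `|t| < r ->
     (fun n : nat => `|t| ^+ n * fine (abs_moment P Y n) / n`!%:R) @ \oo
       --> (0 : R)).

Definition mutually_independent {d : measure_display} {T : measurableType d}
    {R : realType} (P : probability T R) (X : nat -> {RV P >-> R}) : Prop :=
  forall (J : {fset nat}) (B : nat -> set R),
    (forall j, measurable (B j)) ->
    P (\bigcap_(j in [set` J]) (X j @^-1` B j)) =
    (\prod_(j <- J) P (X j @^-1` B j))%E.

(* The copies may live on another probability space than Y itself. *)
Definition iid_copies {d0 d : measure_display} {T0 : measurableType d0}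
    {T : measurableType d} {R : realType} (P0 : probability T0 R)
    (P : probability T R) (Y : {RV P0 >-> R}) (X : nat -> {RV P >-> R}) : Prop :=
  mutually_independent X /\
  (forall (j : nat) (B : set R), measurable B ->
     distribution P (X j) B = distribution P0 Y B).

Section fubini_polynomials.
Context {d : measure_display} {T : measurableType d} {R : realType}.
Variables (P : probability T R) (X : nat -> {RV P >-> R}).

(* Indices are shifted: [X j] is Y_(j+1), so S_i = Y_1 + ... + Y_i. *)
Definition partial_sum (i : nat) (w : T) : R := \sum_(j < i) X j w.

(* P{G_p = i} for G_p geometric on {1, 2, ...} *)
Definition geometric_prob (p : R) (i : nat) : R :=
  if i is j.+1 then p * (1 - p) ^+ j else 0.

Definition eta (x : R) : R := 1 / (1 + x).

Definition fubini_term (n : nat) (x : R) (i : nat) : R :=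
  moment P (partial_sum i) n * geometric_prob (eta x) i.+1.

Definition fubini (n : nat) (x : R) : R := limn (series (fubini_term n x)).

Definition stirling (n k : nat) : R :=
  (k`!%:R)^-1 * \sum_(j < k.+1)
    (-1) ^+ (k - j) * 'C(k, j)%:R * moment P (partial_sum j) n.

Definition fubini_poly (n : nat) : {poly R} :=
  \sum_(k < n.+1) (stirling n k * k`!%:R) *: 'X^k.

End fubini_polynomials.

(* Main.v *)
Require Import Defs.
From HB Require Import structures.
From mathcomp Require Import all_boot all_order all_algebra finmap.
From mathcomp Require Import all_classical all_reals all_analysis.
From mathcomp Require Import measurable_realfun ring lra.

Set Implicit Arguments.
Unset Strict Implicit.
Unset Printing Implicit Defensive.

Import Order.TTheory GRing.Theory Num.Theory.
Import numFieldNormedType.Exports.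

Local Open Scope classical_set_scope.
Local Open Scope ring_scope.

(** Put M(z) = E[exp(z Y)], read as a formal power series whose coefficients
    are the moments of Y divided by factorials. Independence makes the
    exponential generating function of the moments of S_i equal to M(z)^i, so
    that of the polynomials W_n(x) is the geometric mixture
    <<
      W(x, z) = sum_i 1/(1+x) (x/(1+x))^i M(z)^i = 1 / (1 - x (M(z) - 1)).
    >>
    Expanded in powers of x this is sum_k x^k (M(z) - 1)^k, whose coefficients
    are the finite differences defining k! S_Y(n, k). Differentiating in x,
    <<
      dW/dx = (M - 1) W^2 = M W^2 - W^2,
    >>
    and the coefficient of z^n, with the binomial convolution standing for
    products of generating functions, is the announced identity.

    Only the coefficients up to z^n matter, so M is truncated to a polynomial
    of degree n ([egf]) and all identities hold modulo z^(n+1). As z divides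
    M - 1, the geometric sum over k can be truncated at k = n, and
    [geometric_deriv_eq] is the differential equation with an explicit
    remainder that is a multiple of (M - 1)^(n+1).

    Probability enters through the recurrence [moment_partial_sumS]. Mutual
    independence speaks about finitely many events defined by single
    variables, whereas the recurrence needs S_i independent of Y_(i+1); this is
    [indep_partial_sum_tail], proved by adding one summand at a time. Finite
    absolute moments suffice for every exchange of integral and sum. The series
    defining W_n(x) converges because E[S_i^n] is a combination of the binomials
    C(i, j), j <= n, and each sum_i C(i, j) q^i converges ([cvg_bin_geometric]). *)

(** * Independence and expectation of products *)

Lemma measure_eq_on_rectangles (d1 d2 : measure_display) (T1 : measurableType d1)
    (T2 : measurableType d2) (R : realType)
    (m1 m2 : {measure set (T1 * T2) -> \bar R}) :
  (m1 setT < +oo)%E ->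
  (forall A B, measurable A -> measurable B -> m1 (A `*` B) = m2 (A `*` B)) ->
  forall D, measurable D -> m1 D = m2 D.
Proof.
move=> m1oo m12; apply: (measure_unique
    [set A `*` B | A in measurable & B in measurable] (fun=> setT)).
- exact: measurable_prod_measurableType.
- move=> _ _ [A mA [B mB <-]] [A' mA' [B' mB' <-]]; rewrite -setXI.
  exists (A `&` A'); first exact: measurableI.
  by exists (B `&` B'); first exact: measurableI.
- by move=> _; exists setT => //; exists setT => //; rewrite setXTT.
- by apply/seteqP; split => // x _; exists 0%N.
- by move=> _ [A mA [B mB <-]]; exact: m12.
- by move=> _.
Qed.

Section independence.
Context (R : realType) (d : measure_display) (T : measurableType d)
  (P : probability T R).
Local Open Scope ereal_scope.

(** If E is independent of every rectangle event of (S, X), it is independent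
    of every event of (S, X): both sides are finite measures in D, and they
    agree on rectangles, a pi-system generating the product sigma-algebra. *)
Lemma indep_event_joint (d1 d2 : measure_display) (T1 : measurableType d1)
    (T2 : measurableType d2) (S : T -> T1) (X : T -> T2) (E : set T) :
  measurable_fun setT S -> measurable_fun setT X -> measurable E ->
  (forall A B, measurable A -> measurable B ->
     P (S @^-1` A `&` X @^-1` B `&` E) = P (S @^-1` A `&` X @^-1` B) * P E) ->
  forall D, measurable D ->
    P ((fun w => (S w, X w)) @^-1` D `&` E) =
    P ((fun w => (S w, X w)) @^-1` D) * P E.
Proof.
move=> mS mX mE hAB D mD.
have mSX : measurable_fun setT (fun w => (S w, X w)).
  exact: measurable_fun_pair.
have PE0 : (0 <= fine (P E))%R by rewrite fine_ge0.
pose f : {mfun T >-> (T1 * T2)%type} :=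
  HB.pack (fun w => (S w, X w)) (isMeasurableFun.Build _ _ _ _ _ mSX).
pose m1 := pushforward (mrestr P mE) f.
pose m2 := mscale (NngNum PE0) (distribution P f).
have := @measure_eq_on_rectangles _ _ T1 T2 R m1 m2.
rewrite /m1 /m2 /= /mscale/= /distribution /pushforward /mrestr/= => h.
rewrite h//.
- by rewrite muleC fineK// fin_num_measure.
- by rewrite preimage_setT setTI (le_lt_trans (probability_le1 _ mE))// ltry.
- by move=> A B mA mB; rewrite fineK ?fin_num_measure// muleC -hAB.
Qed.

(** Independence says that the joint law is the product of the laws, so
    Tonelli gives integrability and Fubini factors the integral. *)
Lemma expectationM_indep (d1 d2 : measure_display) (T1 : measurableType d1)
    (T2 : measurableType d2) (S : {RV P >-> T1}) (X : {RV P >-> T2})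
    (f : T1 -> R) (g : T2 -> R) :
  (forall A B, measurable A -> measurable B ->
     P (S @^-1` A `&` X @^-1` B) = P (S @^-1` A) * P (X @^-1` B)) ->
  measurable_fun setT f -> measurable_fun setT g ->
  P.-integrable setT (fun w => (f (S w))%:E) ->
  P.-integrable setT (fun w => (g (X w))%:E) ->
  P.-integrable setT (fun w => (f (S w) * g (X w))%:E) /\
  \int[P]_w (f (S w) * g (X w))%:E =
  (\int[P]_w (f (S w))%:E) * (\int[P]_w (g (X w))%:E).
Proof.
move=> ind mf mg intf intg.
pose m1 := distribution P S; pose m2 := distribution P X.
pose Z (w : T) := (S w, X w).
have mZ : measurable_fun setT Z.
  exact: measurable_fun_pair.
pose Zm : {mfun T >-> (T1 * T2)%type} :=
  HB.pack Z (isMeasurableFun.Build _ _ _ _ _ mZ).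
have lawZ D : measurable D -> (m1 \x m2) D = pushforward P Zm D.
  by apply: product_measure_unique => A B mA mB; rewrite -ind.
pose h (z : T1 * T2) : \bar R := (f z.1 * g z.2)%:E.
have mh : measurable_fun setT h.
  apply/measurable_EFinP; apply: measurable_funM.
    exact: (measurableT_comp mf measurable_fst).
  exact: (measurableT_comp mg measurable_snd).
have If : m1.-integrable setT (EFin \o f).
  by apply: (@integrable_pushforward _ _ _ _ _ S) => //; exact/measurable_EFinP.
have Ig : m2.-integrable setT (EFin \o g).
  by apply: (@integrable_pushforward _ _ _ _ _ X) => //; exact/measurable_EFinP.
have Ih : (m1 \x m2).-integrable setT h.
  apply/integrable12ltyP => //.
  rewrite (_ : (fun x => _) = fun x => `|f x|%:E * \int[m2]_y `|(g y)%:E|);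
    last first.
    apply/funext => x; rewrite -ge0_integralZl//; last first.
      exact/measurableT_comp/measurable_EFinP.
    by apply: eq_integral => y _; rewrite /h /= normrM.
  have /integrableP[_ Igoo] := Ig; have /integrableP[_ Ifoo] := If.
  rewrite ge0_integralZr ?integral_ge0//.
    by rewrite lte_mul_pinfty ?integral_ge0// ge0_fin_numE ?integral_ge0.
  by apply: measurableT_comp => //; apply: measurableT_comp.
have IhZ : P.-integrable setT (h \o Z).
  apply/integrableP; split; first exact: measurableT_comp.
  have /integrableP[_] := Ih.
  rewrite (eq_measure_integral (pushforward P Zm)); last first.
    by move=> A mA _; exact: lawZ.
  by rewrite ge0_integral_pushforward//; exact: measurableT_comp.
split; first exact: IhZ.
transitivity (\int[m1 \x m2]_z h z).
  rewrite [RHS](eq_measure_integral (pushforward P Zm)); last first.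
    by move=> A mA _; exact: lawZ.
  by rewrite integral_pushforward.
rewrite -integral12_prod_meas1//.
have fE : \int[P]_w (f (S w))%:E = \int[m1]_x (f x)%:E.
  by rewrite integral_distribution//; exact/measurable_EFinP.
have gE : \int[P]_w (g (X w))%:E = \int[m2]_x (g x)%:E.
  by rewrite integral_distribution//; exact/measurable_EFinP.
rewrite fE gE.
have gfin : \int[m2]_x (g x)%:E \is a fin_num by exact: integrable_fin_num.
rewrite -(fineK gfin) -integralZr//; apply: eq_integral => x _.
rewrite fineK// /fubini_F /h /=.
by rewrite -integralZl//; apply: eq_integral => y _.
Qed.

End independence.

(** * Moments of partial sums *)

Section partial_sums.
Context (R : realType) (d : measure_display) (T : measurableType d)
  (P : probability T R) (X : nat -> {RV P >-> R}).

Lemma measurable_partial_sum i : measurable_fun setT (partial_sum X i).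
Proof. by apply: measurable_sum => j; exact: measurable_funP. Qed.

HB.instance Definition _ i :=
  isMeasurableFun.Build _ _ _ _ (partial_sum X i) (measurable_partial_sum i).

Lemma partial_sum0 : partial_sum X 0 = cst 0.
Proof. by apply/funext => w; rewrite /partial_sum big_ord0. Qed.

Lemma partial_sumS i w : partial_sum X i.+1 w = partial_sum X i w + X i w.
Proof. by rewrite /partial_sum big_ord_recr. Qed.

Hypothesis indepX : mutually_independent X.

Lemma bigcap_preimage_measurable (J : {fset nat}) (B : nat -> set R) :
  (forall j, measurable (B j)) ->
  measurable (\bigcap_(j in [set` J]) (X j @^-1` B j)).
Proof.
move=> mB; apply: fin_bigcap_measurable => // j _.
by rewrite -[_ @^-1` _]setTI; exact: measurable_funP.
Qed.

(** Carrying the whole tail of later variables through the induction is what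
    makes it work: to pass from S_i to S_(i+1) = S_i + X_i, the pair (S_i, X_i)
    must be independent of the events of the remaining variables. *)
Lemma indep_partial_sum_tail i (J : {fset nat}) (A : set R) (B : nat -> set R) :
  (forall j, j \in J -> (i <= j)%N) ->
  measurable A -> (forall j, measurable (B j)) ->
  (P (partial_sum X i @^-1` A `&` \bigcap_(j in [set` J]) (X j @^-1` B j)) =
   P (partial_sum X i @^-1` A) * P (\bigcap_(j in [set` J]) (X j @^-1` B j)))%E.
Proof.
elim: i J A B => [|i IH] J A B Ji mA mB.
  rewrite partial_sum0 preimage_cst; case: ifPn => _.
    by rewrite setTI probability_setT mul1e.
  by rewrite set0I measure0 mul0e.
have iJ : i \notin J by apply/negP => /Ji; rewrite ltnn.
set E := \bigcap_(j in [set` J]) _.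
have mE : measurable E by exact: bigcap_preimage_measurable.
(* The event X_i in C is merged into the family indexed by J, so that both
   mutual independence and the induction hypothesis apply to it. *)
have XE (C : set R) : measurable C ->
    exists B', [/\ forall j, measurable (B' j),
      X i @^-1` C `&` E = \bigcap_(j in [set` (i |` J)%fset]) (X j @^-1` B' j) &
      P (X i @^-1` C `&` E) = (P (X i @^-1` C) * P E)%E].
  move=> mC; pose B' j := if j == i then C else B j.
  have mB' j : measurable (B' j) by rewrite /B'; case: ifP.
  have B'J j : j \in J -> B' j = B j.
    by move=> jJ; rewrite /B'; case: eqP => // ji; rewrite ji (negPf iJ) in jJ.
  have eqB' : X i @^-1` C `&` E =
      \bigcap_(j in [set` (i |` J)%fset]) (X j @^-1` B' j).
    rewrite set_fsetU1 bigcap_setU1 {1}/B' eqxx; congr (_ `&` _).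
    by apply: eq_bigcapr => j /= jJ; rewrite B'J.
  exists B'; split => //.
  rewrite eqB' indepX// big_fsetU1//= {1}/B' eqxx; congr (_ * _)%E.
  by rewrite /E indepX// !big_seq; apply: eq_bigr => j jJ; rewrite B'J.
have iJ' (j : nat) : j \in (i |` J)%fset -> (i <= j)%N.
  by case/fset1UP => [->|/Ji/ltnW].
have rect (C D : set R) : measurable C -> measurable D ->
    P (partial_sum X i @^-1` C `&` (X i @^-1` D `&` E)) =
    (P (partial_sum X i @^-1` C) * (P (X i @^-1` D) * P E))%E.
  move=> mC mD; have [B' [mB' eqB' PB']] := XE D mD.
  by rewrite -PB' eqB' IH.
have pairE (C D : set R) : measurable C -> measurable D ->
    P (partial_sum X i @^-1` C `&` X i @^-1` D) =
    (P (partial_sum X i @^-1` C) * P (X i @^-1` D))%E.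
  move=> mC mD; have := IH [fset i]%fset C (fun=> D) _ mC (fun=> mD).
  by rewrite set_fset1 bigcap_set1; apply => j /fset1P->.
have mX : measurable_fun setT (X i) by exact: measurable_funP.
have := @indep_event_joint R d T P _ _ _ _ (partial_sum X i) (X i) E
  (measurable_partial_sum i) mX mE _
  ((fun z => z.1 + z.2) @^-1` A).
rewrite /preimage /=.
have -> : [set w | A (partial_sum X i w + X i w)] = partial_sum X i.+1 @^-1` A.
  by apply/funext => w; rewrite /preimage/= partial_sumS.
apply.
- by move=> C D mC mD; rewrite -setIA rect// pairE// muleA.
- rewrite -[X in measurable X]setTI.
  by apply: measurable_funD.
Qed.

Lemma indep_partial_sum_next i (A B : set R) : measurable A -> measurable B ->
  (P (partial_sum X i @^-1` A `&` X i @^-1` B) =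
   P (partial_sum X i @^-1` A) * P (X i @^-1` B))%E.
Proof.
move=> mA mB.
have := @indep_partial_sum_tail i [fset i]%fset A (fun=> B) _ mA (fun=> mB).
by rewrite set_fset1 bigcap_set1; apply => j /fset1P->.
Qed.

Hypothesis intX : forall i k, P.-integrable setT (fun w => (X i w ^+ k)%:E).

Lemma integral_partial_sumM_next i k l :
  P.-integrable setT (fun w => (partial_sum X i w ^+ k)%:E) ->
  P.-integrable setT (fun w => (partial_sum X i w ^+ k * X i w ^+ l)%:E) /\
  (\int[P]_w (partial_sum X i w ^+ k * X i w ^+ l)%:E =
   \int[P]_w (partial_sum X i w ^+ k)%:E * \int[P]_w (X i w ^+ l)%:E)%E.
Proof.
move=> iS.
have mpow m : measurable_fun setT (fun s : R => s ^+ m).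
  by apply: measurable_funX; exact: measurable_id.
apply: (@expectationM_indep _ _ _ _ _ _ _ _ (partial_sum X i) (X i)
  (fun s => s ^+ k) (fun s => s ^+ l)) => // A B mA mB.
exact: indep_partial_sum_next.
Qed.

Lemma partial_sum_powS i k w :
  ((partial_sum X i.+1 w ^+ k)%:E = \sum_(j < k.+1) 'C(k, j)%:R%:E *
     (partial_sum X i w ^+ j * X i w ^+ (k - j))%:E)%E.
Proof.
rewrite partial_sumS addrC exprDn -sumEFin; apply: eq_bigr => j _.
by rewrite -EFinM mulr_natl mulrC.
Qed.

Lemma integrable_partial_sum i k :
  P.-integrable setT (fun w => (partial_sum X i w ^+ k)%:E).
Proof.
elim: i k => [|i IH] k.
  rewrite partial_sum0; exact: (finite_measure_integrable_cst P (0 ^+ k)).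
under eq_fun do rewrite partial_sum_powS.
apply: integrable_sum => // j _; apply: integrableZl => //.
by have [] := integral_partial_sumM_next (k - j) (IH j).
Qed.

Lemma moment_partial_sumE i k : (moment P (partial_sum X i) k)%:E =
  (\int[P]_w (partial_sum X i w ^+ k)%:E)%E.
Proof.
rewrite /moment unlock fineK//.
exact: integrable_fin_num (integrable_partial_sum i k).
Qed.

Lemma moment_partial_sum0 k : moment P (partial_sum X 0) k = (k == 0)%:R.
Proof.
rewrite /moment partial_sum0 -expr0n.
exact: (congr1 fine (expectation_cst P (0 ^+ k))).
Qed.

(** Binomial theorem for S_i + X_i, each mixed term being factored by
    independence; in generating functions, multiplication by that of X_i. *)
Lemma moment_partial_sumS i k : moment P (partial_sum X i.+1) k =
  \sum_(j < k.+1) 'C(k, j)%:R * moment P (X i) (k - j) *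
    moment P (partial_sum X i) j.
Proof.
apply: EFin_inj; rewrite moment_partial_sumE.
under eq_integral do rewrite partial_sum_powS.
rewrite integral_sum//; last first.
  move=> j; apply: integrableZl => //.
  by have [] := integral_partial_sumM_next (k - j) (integrable_partial_sum i j).
rewrite -sumEFin; apply: eq_bigr => j _.
have [iSX SXE] := integral_partial_sumM_next (k - j) (integrable_partial_sum i j).
have XE : (moment P (X i) (k - j))%:E = (\int[P]_w (X i w ^+ (k - j))%:E)%E.
  by rewrite /moment unlock fineK// integrable_fin_num//; exact: intX.
by rewrite integralZl// SXE -moment_partial_sumE -XE -!EFinM mulrA mulrAC.
Qed.

End partial_sums.

Lemma moment_distribution (R : realType) (d0 d : measure_display)
    (T0 : measurableType d0) (P0 : probability T0 R) (Y : {RV P0 >-> R})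
    (T : measurableType d) (P : probability T R) (X : {RV P >-> R}) (k : nat) :
  (forall B, measurable B -> distribution P X B = distribution P0 Y B) ->
  (abs_moment P0 Y k < +oo)%E ->
  P.-integrable setT (fun w => (X w ^+ k)%:E) /\ moment P X k = moment P0 Y k.
Proof.
move=> XY Yoo.
have mpow : measurable_fun [set: R] (EFin \o (fun s : R => s ^+ k)).
  by apply/measurable_EFinP/measurable_funX; exact: measurable_id.
have mX : measurable_fun setT X by exact: measurable_funP.
have mY : measurable_fun setT Y by exact: measurable_funP.
have intY : P0.-integrable setT (fun w => (Y w ^+ k)%:E).
  apply/integrableP; split; first exact: (measurableT_comp mpow mY).
  move: Yoo; rewrite /abs_moment unlock.
  by under [in X in _ -> X]eq_integral do rewrite /= normrX.
have intX : P.-integrable setT (fun w => (X w ^+ k)%:E).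
  apply/integrableP; split; first exact: (measurableT_comp mpow mX).
  have mabs : measurable_fun [set: R] (abse \o (EFin \o (fun s : R => s ^+ k))).
    exact: measurableT_comp.
  rewrite -(@ge0_integral_distribution _ _ _ _ _ P X _ mabs); last first.
    by move=> s; exact: abse_ge0.
  rewrite (eq_measure_integral (distribution P0 Y)); last first.
    by move=> B mB _; exact: (XY B mB).
  rewrite (@ge0_integral_distribution _ _ _ _ _ P0 Y _ mabs); last first.
    by move=> s; exact: abse_ge0.
  by move/integrableP : intY => [].
split=> //; rewrite /moment unlock; congr fine.
rewrite -(@integral_distribution _ _ _ _ _ P X _ mpow)//.
rewrite (eq_measure_integral (distribution P0 Y)); last first.
  by move=> B mB _; exact: (XY B mB).
by rewrite integral_distribution.
Qed.

(** * The truncated differential equation *)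

Lemma geometric_mul1B (A : comNzRingType) (x a : A) (m : nat) :
  (\sum_(j < m) x ^+ j * a ^+ j) * (1 - x * a) = 1 - (x * a) ^+ m.
Proof.
elim: m => [|m IH]; first by rewrite big_ord0 mul0r expr0 subrr.
by rewrite big_ord_recr/= mulrDl IH -exprMn exprS; ring.
Qed.

(** Formal derivative with respect to x of [geometric_mul1B]. *)
Lemma geometric_deriv_mul1B (A : comNzRingType) (x a : A) (m : nat) :
  (\sum_(j < m) x ^+ j.-1 *+ j * a ^+ j) * (1 - x * a) =
  a * (\sum_(j < m) x ^+ j * a ^+ j) - x ^+ m.-1 *+ m * a ^+ m.
Proof.
elim: m => [|m IH]; first by rewrite !big_ord0 mulr0n !mul0r mulr0 subr0.
rewrite !big_ord_recr/= mulrDl IH [a * (_ + _)]mulrDr.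
have -> : x ^+ m.-1 *+ m * a ^+ m * (1 - x * a) =
    x ^+ m.-1 *+ m * a ^+ m - x ^+ m *+ m * a ^+ m.+1.
  case: m {IH} => [|m]; first by rewrite !mulr0n !mul0r subr0.
  by rewrite /= -[x ^+ m *+ _]mulr_natl -[x ^+ m.+1 *+ _]mulr_natl !exprS; ring.
by rewrite mulrSr exprS; ring.
Qed.

(** With G the truncation of 1 / (1 - x a) and D its derivative in x, this is
    D = a G^2 modulo a^m: multiply D by G (1 - x a), which is 1 modulo a^m,
    and use D (1 - x a) = a G modulo a^m. *)
Lemma geometric_deriv_eq (A : comNzRingType) (x a : A) (m : nat) :
  exists r, \sum_(j < m) x ^+ j.-1 *+ j * a ^+ j =
            a * (\sum_(j < m) x ^+ j * a ^+ j) ^+ 2 + a ^+ m * r.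
Proof.
have := geometric_mul1B x a m; have := geometric_deriv_mul1B x a m.
set D := (X in X * _ = _ -> _); set G := (X in _ = a * X - _ -> _) => hD hG.
exists (D * x ^+ m - x ^+ m.-1 *+ m * G).
have hG1 : G * (1 - x * a) + x ^+ m * a ^+ m = 1 by rewrite hG exprMn subrK.
rewrite -[LHS]mulr1 -hG1 mulrDr mulrCA hD.
move: (x ^+ m.-1 *+ m) (x ^+ m) (a ^+ m) => s u v; rewrite -/D -/G; ring.
Qed.

(** * Exponential generating functions of the moments *)

Section egf.
Variable R : numFieldType.
Implicit Types (p q : {poly R}) (x : R).

Definition egf_coef p k : R := p`_k * k`!%:R.

Lemma egf_coefM p q k :
  egf_coef (p * q) k =
  \sum_(i < k.+1) 'C(k, i)%:R * egf_coef p i * egf_coef q (k - i).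
Proof.
rewrite /egf_coef coefM big_distrl/=; apply: eq_bigr => i _.
have ik : (i <= k)%N by rewrite -ltnS.
by rewrite -(bin_fact ik) !natrM; ring.
Qed.

Lemma egf_coef_sum (I : Type) (s : seq I) (F : I -> {poly R}) k :
  egf_coef (\sum_(i <- s) F i) k = \sum_(i <- s) egf_coef (F i) k.
Proof. by rewrite /egf_coef coef_sum big_distrl. Qed.

Lemma egf_coefCM x p k : egf_coef (x%:P * p) k = x * egf_coef p k.
Proof. by rewrite /egf_coef coefCM mulrA. Qed.

Lemma egf_coefD p q k : egf_coef (p + q) k = egf_coef p k + egf_coef q k.
Proof. by rewrite /egf_coef coefD mulrDl. Qed.

Lemma egf_coefMXn p k m : (k < m)%N -> egf_coef ('X^m * p) k = 0.
Proof. by move=> km; rewrite /egf_coef coefXnM km mul0r. Qed.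

(** In the application y k is the k-th moment of one summand and mu i k the
    k-th moment of a sum of i summands. *)
Variables (n : nat) (y : nat -> R) (mu : nat -> nat -> R).
Hypothesis y0 : y 0%N = 1.
Hypothesis mu0 : forall k, mu 0%N k = (k == 0%N)%:R.
Hypothesis muS : forall i k,
  mu i.+1 k = \sum_(j < k.+1) 'C(k, j)%:R * y (k - j) * mu i j.

Definition egf : {poly R} := \poly_(i < n.+1) (y i / i`!%:R).

Lemma egf_coef_egf k : (k <= n)%N -> egf_coef egf k = y k.
Proof.
by move=> kn; rewrite /egf_coef coef_poly ltnS kn divfK.
Qed.

Lemma egf_coef_egfX i k : (k <= n)%N -> egf_coef (egf ^+ i) k = mu i k.
Proof.
elim: i k => [|i IH] k kn.
  by rewrite expr0 mu0 /egf_coef coef1; case: k {kn} => [|k]; rewrite ?mul0r ?mulr1.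
rewrite exprSr egf_coefM muS; apply: eq_bigr => j _.
have jk : (j <= k)%N by rewrite -ltnS.
rewrite IH ?(leq_trans jk)// egf_coef_egf ?(leq_trans (leq_subr _ _))//; ring.
Qed.

Definition egf_subX : {poly R} := drop_poly 1 (egf - 1).

(** y 0 = 1 cancels the constant coefficient, so the powers of egf - 1 vanish
    to increasing order; this is what bounds every sum below. *)
Lemma egf_sub1E : egf - 1 = 'X * egf_subX.
Proof.
rewrite -[LHS](poly_take_drop 1) expr1 mulrC -[RHS]add0r; congr (_ + _).
apply/polyP => i; rewrite coef_take_poly coef0; case: i => //=.
by rewrite coefB coef1 coef_poly/= y0 fact0 divr1 subrr.
Qed.

Definition finite_diff k j : R :=
  \sum_(i < j.+1) (-1) ^+ (j - i) * 'C(j, i)%:R * mu i k.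

Lemma finite_diffE k j : (k <= n)%N ->
  finite_diff k j = egf_coef ((egf - 1) ^+ j) k.
Proof.
move=> kn; rewrite addrC exprDn egf_coef_sum; apply: eq_bigr => i _.
rewrite -egf_coef_egfX// -egf_coefCM; congr egf_coef.
by rewrite polyCM polyC_exp polyCN polyC_natr -mulrA mulrCA mulr_natl.
Qed.

Lemma finite_diff0 k j : (k < j)%N -> (k <= n)%N -> finite_diff k j = 0.
Proof. by move=> kj kn; rewrite finite_diffE// egf_sub1E exprMn egf_coefMXn. Qed.

(** Expand the i-th power of 1 + (egf - 1): mu i k is polynomial in i, of degree
    at most k, written in Newton's binomial basis. *)
Lemma finite_diff_inv i k : (k <= n)%N ->
  mu i k = \sum_(j < k.+1) 'C(i, j)%:R * finite_diff k j.
Proof.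
move=> kn; have mE : mu i k = \sum_(j < i.+1) 'C(i, j)%:R * finite_diff k j.
  rewrite -egf_coef_egfX// -[egf](subrK 1) addrC exprDn egf_coef_sum.
  apply: eq_bigr => j _; rewrite expr1n mul1r finite_diffE//.
  by rewrite -mulr_natl -polyC_natr egf_coefCM.
(* The binomial expansion stops at j = i and the claim at j = k; both sums
   equal the one up to maxn i k. *)
pose F j := 'C(i, j)%:R * finite_diff k j.
have Fk N : (k <= N)%N -> \sum_(j < N.+1) F j = \sum_(j < k.+1) F j.
  move=> kN; rewrite -!(big_mkord xpredT F) (@big_cat_nat _ _ _ k.+1)//=.
  rewrite [X in _ + X]big_nat [X in _ + X]big1 ?addr0// => j /andP[kj _].
  by rewrite /F finite_diff0// mulr0.
have Fi N : (i <= N)%N -> \sum_(j < N.+1) F j = \sum_(j < i.+1) F j.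
  move=> iN; rewrite -!(big_mkord xpredT F) (@big_cat_nat _ _ _ i.+1)//=.
  rewrite [X in _ + X]big_nat [X in _ + X]big1 ?addr0// => j /andP[ij _].
  by rewrite /F bin_small// mul0r.
by rewrite mE -(Fi (maxn i k)) ?leq_maxl// Fk// leq_maxr.
Qed.

Definition fubini_of_moments k : {poly R} :=
  \sum_(j < k.+1) finite_diff k j *: 'X^j.

(** The truncation of 1 / (1 - x (egf - 1)). *)
Definition fubini_egf x : {poly R} :=
  \sum_(j < n.+1) x%:P ^+ j * (egf - 1) ^+ j.

Lemma fubini_of_moments_widen k : (k <= n)%N ->
  fubini_of_moments k = \sum_(j < n.+1) finite_diff k j *: 'X^j.
Proof.
move=> kn; rewrite /fubini_of_moments.
rewrite -!(big_mkord xpredT (fun j => finite_diff k j *: 'X^j)).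
rewrite [RHS](@big_cat_nat _ _ _ k.+1)//=.
rewrite [X in _ + X]big_nat [X in _ + X]big1 ?addr0// => j /andP[kj _].
by rewrite finite_diff0// scale0r.
Qed.

Lemma egf_coef_fubini x k : (k <= n)%N ->
  egf_coef (fubini_egf x) k = (fubini_of_moments k).[x].
Proof.
move=> kn; rewrite fubini_of_moments_widen// horner_sum egf_coef_sum.
apply: eq_bigr => j _.
by rewrite -polyC_exp egf_coefCM -finite_diffE// hornerZ hornerXn mulrC.
Qed.

Lemma deriv_fubini_of_moments x :
  (fubini_of_moments n)^`().[x] = \sum_(k < n.+1) 'C(n, k)%:R *
    (y (n - k) * (\sum_(i < k.+1) 'C(k, i)%:R * (fubini_of_moments i).[x] *
                    (fubini_of_moments (k - i)).[x])
     - (fubini_of_moments k).[x] * (fubini_of_moments (n - k)).[x]).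
Proof.
have [r hr] := geometric_deriv_eq x%:P (egf - 1) n.+1.
transitivity (egf_coef ((egf - 1) * fubini_egf x ^+ 2) n).
  transitivity (egf_coef
      (\sum_(j < n.+1) x%:P ^+ j.-1 *+ j * (egf - 1) ^+ j) n).
    rewrite /fubini_of_moments raddf_sum/= horner_sum egf_coef_sum.
    apply: eq_bigr => j _.
    rewrite -polyC_exp -polyCMn egf_coefCM -finite_diffE// derivZ derivXn.
    by rewrite hornerZ hornerMn hornerXn mulrC.
  rewrite hr egf_coefD [X in _ + X](_ : _ = 0) ?addr0//.
  by rewrite egf_sub1E exprMn -mulrA egf_coefMXn.
have sq k : (k <= n)%N -> egf_coef (fubini_egf x ^+ 2) k =
    \sum_(i < k.+1) 'C(k, i)%:R * (fubini_of_moments i).[x] *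
      (fubini_of_moments (k - i)).[x].
  move=> kn; rewrite expr2 egf_coefM; apply: eq_bigr => i _.
  have ik : (i <= k)%N by rewrite -ltnS.
  by rewrite !egf_coef_fubini// ?(leq_trans ik)// (leq_trans (leq_subr _ _)).
rewrite mulrBl mul1r /egf_coef coefB mulrBl -!/(egf_coef _ _) sq// mulrC egf_coefM.
rewrite -sumrB; apply: eq_bigr => k _.
have kn : (k <= n)%N by rewrite -ltnS.
by rewrite sq// egf_coef_egf ?leq_subr//; ring.
Qed.

End egf.

(** * Convergence of the geometric mixture *)

(** Pascal's rule gives b(m+1) = q a(m) + q b(m) for the partial sums a, b at j
    and j + 1. Since b is nondecreasing this bounds b(m) by q lim a / (1 - q),
    hence b converges, and passing to the limit in the recurrence gives its sum. *)
Lemma cvg_bin_geometric (R : realType) (q : R) (j : nat) : 0 <= q < 1 ->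
  series (fun i => 'C(i, j)%:R * q ^+ i) @ \oo --> q ^+ j / (1 - q) ^+ j.+1.
Proof.
move=> /andP[q0 q1]; have q1' : 0 < 1 - q by rewrite subr_gt0.
elim: j => [|j IH].
  rewrite expr0 expr1.
  have -> : (fun i => 'C(i, 0)%:R * q ^+ i) = geometric 1 q.
    by apply/funext => i /=; rewrite bin0 !mul1r.
  by apply: cvg_geometric_series; rewrite ger0_norm.
set a := fun i => 'C(i, j)%:R * q ^+ i in IH *.
set b := fun i => 'C(i, j.+1)%:R * q ^+ i.
have pascal m : series b m.+1 = q * series a m + q * series b m.
  rewrite /series/= big_nat_recl// {1}/b bin0n/= mul0r add0r.
  rewrite !big_distrr -big_split; apply: eq_bigr => i _.
  by rewrite /a /b binS natrD exprS /=; ring.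
have b0 i : 0 <= b i by rewrite mulr_ge0 ?exprn_ge0.
have a0 i : 0 <= a i by rewrite mulr_ge0 ?exprn_ge0.
have nda : nondecreasing_seq (series a) by apply: nondecreasing_series.
have ndb : nondecreasing_seq (series b) by apply: nondecreasing_series.
have cvb : cvgn (series b).
  apply: nondecreasing_is_cvgn => //.
  exists (q * limn (series a) / (1 - q)) => _ [m _ <-].
  rewrite ler_pdivlMr//.
  have := ndb _ _ (leqnSn m); rewrite pascal => h.
  have h2 : series a m <= limn (series a).
    by apply: nondecreasing_cvgn_le => //; apply/cvg_ex; eexists; exact: IH.
  have := ler_wpM2l q0 h2; lra.
have lb : limn (series b) = q * (q ^+ j / (1 - q) ^+ j.+1) + q * limn (series b).
  apply: (@cvg_lim R) => //.
  rewrite -(cvg_shiftS (series b)).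
  rewrite [X in X @ _ --> _](_ : _ = (fun m => q * series a m + q * series b m));
    last by apply/funext => m /=; exact: pascal.
  by apply: cvgD; apply: cvgMl_tmp.
suff -> : q ^+ j.+1 / (1 - q) ^+ j.+2 = limn (series b) by [].
have -> : q ^+ j.+1 / (1 - q) ^+ j.+2 = q * (q ^+ j / (1 - q) ^+ j.+1) / (1 - q).
  by rewrite (exprS q) (exprS _ j.+1) invfM; ring.
apply: (mulIf (lt0r_neq0 q1')); rewrite divfK ?lt0r_neq0//.
by rewrite mulrBr mulr1 {1}lb (mulrC _ q) addrK.
Qed.

(** With q = x / (1 + x), the mean of C(i, j) under the geometric weights is
    (1 - q) q^j / (1 - q)^(j+1) = x^j. *)
Lemma cvg_geometric_expectation (R : realType) (x : R) (n : nat)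
    (c m : nat -> R) : 0 <= x ->
  (forall i, m i = \sum_(j < n.+1) 'C(i, j)%:R * c j) ->
  series (fun i => m i * geometric_prob (Defs.eta x) i.+1) @ \oo -->
    \sum_(j < n.+1) c j * x ^+ j.
Proof.
move=> x0 mE.
have x1 : 0 < 1 + x by rewrite ltr_pwDl.
have q0 : 0 <= 1 - Defs.eta x < 1.
  have e0 : 0 < Defs.eta x by rewrite divr_gt0.
  have e1 : Defs.eta x <= 1 by rewrite ler_pdivrMr// mul1r lerDl.
  lra.
set q := 1 - Defs.eta x in q0.
have -> : series (fun i => m i * geometric_prob (Defs.eta x) i.+1) =
    (fun N => \sum_(j < n.+1) (c j * Defs.eta x) *
        series (fun i => 'C(i, j)%:R * q ^+ i) N).
  apply/funext => N; rewrite /series/=.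
  under [RHS]eq_bigr do rewrite big_distrr/=.
  rewrite exchange_big/=; apply: eq_bigr => i _.
  rewrite mE big_distrl; apply: eq_bigr => j _ /=; rewrite -/q; ring.
apply: (@cvg_big _ _ +%R 0) => //= [|j _]; first exact: add_continuous.
have -> : c j * x ^+ j =
    (c j * Defs.eta x) * (q ^+ j / (1 - q) ^+ j.+1).
  rewrite -mulrA; congr (_ * _).
  have -> : 1 - q = Defs.eta x by rewrite /q subKr.
  have -> : q = x * Defs.eta x by rewrite /q /Defs.eta; field; rewrite gt_eqF.
  have e0 : Defs.eta x != 0 by rewrite /Defs.eta gt_eqF ?divr_gt0.
  by rewrite exprMn exprS; field; rewrite expf_neq0// e0.
by apply: cvgMl_tmp; exact: cvg_bin_geometric.
Qed.

(** * The derivative of the Fubini polynomials *)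

Theorem theorem2p2 (R : realType)
    (d0 : measure_display) (T0 : measurableType d0) (P0 : probability T0 R)
    (Y : {RV P0 >-> R})
    (d : measure_display) (T : measurableType d) (P : probability T R)
    (Ys : nat -> {RV P >-> R})
    (hY : in_class_G Y) (hYs : iid_copies Y Ys) (n : nat) (x : R)
    (hx : 0 <= x) :
  [/\ cvgn (series (fubini_term Ys n x)),
      fubini Ys n x = (fubini_poly Ys n).[x] &
      (fubini_poly Ys n)^`().[x] =
      \sum_(k < n.+1) 'C(n, k)%:R *
        (moment P0 Y (n - k) *
           (\sum_(i < k.+1) 'C(k, i)%:R *
              fubini Ys i x * fubini Ys (k - i) x)
         - fubini Ys k x * fubini Ys (n - k) x)].
Proof.
case: hYs => indep law; case: hY => Yoo _.
have mom j k := @moment_distribution R d0 d T0 P0 Y T P (Ys j) k (law j) (Yoo k).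
have intY j k : P.-integrable setT (fun w => (Ys j w ^+ k)%:E).
  by have [] := mom j k.
have momY j k : moment P (Ys j) k = moment P0 Y k by have [] := mom j k.
pose y k := moment P0 Y k; pose mu i k := moment P (partial_sum Ys i) k.
have y0 : y 0%N = 1.
  by rewrite /y /moment -[X in fine X]/('E_P0[cst 1%R])%E expectation_cst.
have mu0 k : mu 0%N k = (k == 0%N)%:R by exact: moment_partial_sum0.
have muS i k : mu i.+1 k = \sum_(j < k.+1) 'C(k, j)%:R * y (k - j)%N * mu i j.
  by rewrite /mu moment_partial_sumS//; apply: eq_bigr => j _; rewrite momY.
have polyE k : fubini_poly Ys k = fubini_of_moments mu k.
  apply: eq_bigr => j _.
  by rewrite /stirling /finite_diff mulrAC mulVf ?mul1r.
have cvgW k : series (fubini_term Ys k x) @ \oo --> (fubini_poly Ys k).[x].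
  rewrite polyE horner_sum.
  under eq_bigr do rewrite hornerZ hornerXn.
  apply: cvg_geometric_expectation => // i.
  exact: (finite_diff_inv y0 mu0 muS i (leqnn k)).
have fubE k : fubini Ys k x = (fubini_poly Ys k).[x] by exact/cvg_lim.
split=> //; first by apply/cvg_ex; eexists; exact: cvgW.
rewrite polyE (deriv_fubini_of_moments n y0 mu0 muS); apply: eq_bigr => k _.
rewrite !fubE !polyE; congr (_ * (_ * _ - _)).
by apply: eq_bigr => i _; rewrite !fubE !polyE.
Qed.
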